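(* For every $S\in\mathbf{Hrs}$: (i) for every $\alpha$ and every $\sigma$, if $\mathcal{W}^I_S(\sigma,\alpha)$ then $\alpha\in\mathcal{E}_S$; (ii) for every $\alpha$ and every $\tau$, if $\mathcal{W}^{II}_S(\tau,\alpha)$ then $\alpha\in\mathcal{A}_S$; (iii) for every $\alpha$, if $\alpha\in\mathcal{E}_S$, then for some $\sigma$, $\mathcal{W}^I_S(\sigma,\alpha)$; (iv) for every $\alpha$, if $\alpha\in\mathcal{A}_S$, then for some $\tau$, $\mathcal{W}^{II}_S(\tau,\alpha)$. (Here $\alpha,\sigma,\tau$ range over $\omega^\omega$.)
   Context: Setting: intuitionistic mathematics (intuitionistic logic), assuming the Second Axiom of Countable Choice (if $\forall m\exists\alpha\in\omega^\omega[mR\alpha]$ then there is $\alpha$ with $\forall m[mR\alpha^m]$, where $\alpha^m(k)=\alpha(\langle m\rangle\ast k)$) and induction over the inductively defined class $\mathbf{Hrs}$. Finite sequences of natural numbers are coded bijectively by natural numbers; $s\ast t$ is concatenation, $\langle\,\rangle$ the empty sequence, $\overline{s}n$ the initial segment of $s$ of length $n$, $t\sqsubset s$ means $t$ is a proper initial segment of $s$; $(m,n)$ denotes a fixed pairing bijection $\omega\times\omega\to\omega$. For $X\subseteq\omega$ and a code $s$: $X\upharpoonright s=\{t\mid s\ast t\in X\}$; for $\alpha\in\omega^\omega$: $(\alpha\upharpoonright s)(t)=\alpha(s\ast t)$. $\mathbf{Hrs}$ (hereditarily repetitive nonzero stumps) is the least class of subsets of $\omega$ such that $1^\ast:=\{\langle\,\rangle\}\in\mathbf{Hrs}$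 and, for every sequence $S_0,S_1,\dots$ in $\mathbf{Hrs}$, $\{\langle\,\rangle\}\cup\bigcup_{m,n}\langle(m,n)\rangle\ast S_n\in\mathbf{Hrs}$ (every element arises this way). For $S\in\mathbf{Hrs}$, its border is $S'=\{s\mid s\notin S\wedge\forall t[t\sqsubset s\rightarrow t\in S]\}$. Leading sets: $\mathcal{E}_{1^\ast}=\{\alpha\mid\exists n[\alpha(\langle n\rangle)\neq0]\}$, $\mathcal{A}_{1^\ast}=\{\alpha\mid\forall n[\alpha(\langle n\rangle)=0]\}$, and for $S\neq1^\ast$: $\mathcal{E}_S=\{\alpha\mid\exists n[\alpha\upharpoonright\langle n\rangle\in\mathcal{A}_{S\upharpoonright\langle n\rangle}]\}$, $\mathcal{A}_S=\{\alpha\mid\forall n[\alpha\upharpoonright\langle n\rangle\in\mathcal{E}_{S\upharpoonright\langle n\rangle}]\}$. Strategies: $s\in_I\sigma$ iff $\forall n[2n<\mathrm{length}(s)\rightarrow s(2n)=\sigma(\overline{s}(2n))]$; $s\in_{II}\tau$ iff $\forall n[2n+1<\mathrm{length}(s)\rightarrow s(2n+1)=\tau(\overline{s}(2n+1))]$. $\mathcal{W}^I_S(\sigma,\alpha)$ holds iff for all $s\in S'$ with $s\in_I\sigma$: if $\mathrm{length}(s)$ is even then $\alpha(s)=0$, and if $\mathrm{length}(s)$ is odd then $\alpha(s)\neq0$. $\mathcal{W}^{II}_S(\tau,\alpha)$ holds iff for all $s\in S'$ with $s\in_{II}\tau$: if $\mathrm{length}(s)$ is even then $\alpha(s)\neq0$,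 and if odd then $\alpha(s)=0$. *)

(* Defs.v *)
From mathcomp Require Import all_boot.
From Stdlib Require Cantor.
Set Implicit Arguments. Unset Strict Implicit. Unset Printing Implicit Defensive.

(* Finite sequences of naturals are identified with their codes under the
   bijection [CodeSeq.code : seq nat -> nat] (inverse [CodeSeq.decode]), and the
   pairing function is [Cantor.to_nat : nat * nat -> nat], also a bijection. *)

Definition single (n : nat) : nat := CodeSeq.code [:: n].
Definition empty : nat := CodeSeq.code [::].
Definition len (s : nat) : nat := size (CodeSeq.decode s).
Definition entry (s n : nat) : nat := nth 0 (CodeSeq.decode s) n.
Definition concat (s t : nat) : nat :=
  CodeSeq.code (CodeSeq.decode s ++ CodeSeq.decode t).
Definition initial (s n : nat) : nat := CodeSeq.code (take n (CodeSeq.decode s)).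
Definition proper_initial (t s : nat) : Prop :=
  exists2 n, n < len s & t = initial s n.
Definition pairing (m n : nat) : nat := Cantor.to_nat (m, n).

Definition baire : Type := nat -> nat.
Definition nat_set : Type := nat -> Prop.

Definition set_eq (X Y : nat_set) : Prop := forall s, X s <-> Y s.

Definition restr_set (X : nat_set) (s : nat) : nat_set := fun t => X (concat s t).
Definition restr (alpha : baire) (s : nat) : baire := fun t => alpha (concat s t).

(* Second Axiom of Countable Choice.  Elements of Baire space are equal when they
   agree at every argument, so relations are required to respect this equality;
   [restr alpha (single m)] is the m-th component of alpha. *)
Definition second_countable_choice : Prop :=
  forall R : nat -> baire -> Prop,
    (forall m alpha beta, alpha =1 beta -> R m alpha -> R m beta) ->
    (forall m, exists alpha, R m alpha) ->
    exists alpha : baire, forall m, R m (restr alpha (single m)).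

Definition one_star : nat_set := fun s => s = empty.

Definition hrs_sup (T : nat -> nat_set) : nat_set := fun s =>
  s = empty \/
  exists m n t, T n t /\ s = concat (single (pairing m n)) t.

(* The class is closed under extensional equality of subsets. *)
Inductive Hrs : nat_set -> Prop :=
| Hrs_one S : set_eq S one_star -> Hrs S
| Hrs_sup S (T : nat -> nat_set) :
    (forall n, Hrs (T n)) -> set_eq S (hrs_sup T) -> Hrs S.

Definition border (S : nat_set) : nat_set := fun s =>
  ~ S s /\ forall t, proper_initial t s -> S t.

(* The definition by recursion on S is rendered as a mutual inductive predicate
   with one constructor per clause; the four lemmas below are the recursion
   equations, which determine both predicates for S in Hrs. *)
Inductive leadE : nat_set -> baire -> Prop :=
| leadE_one S alpha n :
    set_eq S one_star -> alpha (single n) <> 0 -> leadE S alpha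
| leadE_step S alpha n :
    ~ set_eq S one_star ->
    leadA (restr_set S (single n)) (restr alpha (single n)) -> leadE S alpha
with leadA : nat_set -> baire -> Prop :=
| leadA_one S alpha :
    set_eq S one_star -> (forall n, alpha (single n) = 0) -> leadA S alpha
| leadA_step S alpha :
    ~ set_eq S one_star ->
    (forall n, leadE (restr_set S (single n)) (restr alpha (single n))) ->
    leadA S alpha.

Lemma leadE_oneP S alpha : set_eq S one_star ->
  leadE S alpha <-> exists n, alpha (single n) <> 0.
Proof.
move=> S1; split=> [H|[n]]; last exact: leadE_one.
by case: H S1 => {}S {}alpha n => [_ an _ | nS1 _ S1]; [exists n | case: nS1].
Qed.

Lemma leadA_oneP S alpha : set_eq S one_star ->
  leadA S alpha <-> forall n, alpha (single n) = 0.
Proof.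
move=> S1; split=> [H|?]; last exact: leadA_one.
by case: H S1 => {}S {}alpha // nS1 _ S1; case: nS1.
Qed.

Lemma leadE_stepP S alpha : ~ set_eq S one_star ->
  leadE S alpha <->
  exists n, leadA (restr_set S (single n)) (restr alpha (single n)).
Proof.
move=> nS1; split=> [H|[n]]; last exact: leadE_step.
by case: H nS1 => {}S {}alpha n => [S1 _ nS1 | _ An _]; [case: nS1 | exists n].
Qed.

Lemma leadA_stepP S alpha : ~ set_eq S one_star ->
  leadA S alpha <->
  forall n, leadE (restr_set S (single n)) (restr alpha (single n)).
Proof.
move=> nS1; split=> [H|?]; last exact: leadA_step.
by case: H nS1 => {}S {}alpha // S1 _ nS1; case: nS1.
Qed.

Definition follows_I (s : nat) (sigma : baire) : Prop :=
  forall n, 2 * n < len s -> entry s (2 * n) = sigma (initial s (2 * n)).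

Definition follows_II (s : nat) (tau : baire) : Prop :=
  forall n, 2 * n + 1 < len s ->
    entry s (2 * n + 1) = tau (initial s (2 * n + 1)).

Definition winning_I (S : nat_set) (sigma alpha : baire) : Prop :=
  forall s, border S s -> follows_I s sigma ->
    (~~ odd (len s) -> alpha s = 0) /\ (odd (len s) -> alpha s <> 0).

Definition winning_II (S : nat_set) (tau alpha : baire) : Prop :=
  forall s, border S s -> follows_II s tau ->
    (~~ odd (len s) -> alpha s <> 0) /\ (odd (len s) -> alpha s = 0).

(* Main.v *)
Require Import Defs.
From mathcomp Require Import all_boot.
From Stdlib Require Cantor.

(** A strategy of player I in the game on [S] is a first move [n] followed by a
    strategy of player II in the game on [S |` <n>]; a strategy of player II is
    a family, indexed by the first move [n] of the opponent, of strategies of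
    player I in these games. Through this decomposition the winning conditions
    satisfy the same recursion as the leading sets, and the theorem follows by
    induction on [Hrs]. Countable choice is used only to assemble a strategy of
    player II from strategies which are merely known to exist. *)

Lemma decode_cons n t :
  CodeSeq.decode (concat (single n) t) = n :: CodeSeq.decode t.
Proof. by rewrite /concat /single !CodeSeq.codeK. Qed.

Lemma concat_empty s : concat s empty = s.
Proof. by rewrite /concat /empty CodeSeq.codeK cats0 CodeSeq.decodeK. Qed.

Lemma len_empty : len empty = 0.
Proof. by rewrite /len /empty CodeSeq.codeK. Qed.

Lemma len_cons n t : len (concat (single n) t) = (len t).+1.
Proof. by rewrite /len decode_cons. Qed.

Lemma concat_single_neq_empty n t : concat (single n) t <> empty.
Proof. by move/(congr1 len); rewrite len_cons len_empty. Qed.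

Lemma concat_single_inj m n s t :
  concat (single m) s = concat (single n) t -> m = n /\ s = t.
Proof.
move/(congr1 CodeSeq.decode); rewrite !decode_cons => -[-> st].
by split=> //; rewrite -(CodeSeq.decodeK s) st CodeSeq.decodeK.
Qed.

Lemma empty_or_cons s : s = empty \/ exists n t, s = concat (single n) t.
Proof.
case E: (CodeSeq.decode s) => [|n u]; [left | right].
  by rewrite -(CodeSeq.decodeK s) E.
exists n, (CodeSeq.code u).
by rewrite -(CodeSeq.decodeK s) E /concat /single !CodeSeq.codeK.
Qed.

Lemma entry_cons0 n t : entry (concat (single n) t) 0 = n.
Proof. by rewrite /entry decode_cons. Qed.

Lemma entry_consS n t k : entry (concat (single n) t) k.+1 = entry t k.
Proof. by rewrite /entry decode_cons. Qed.

Lemma initial0 s : initial s 0 = empty.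
Proof. by rewrite /initial take0. Qed.

Lemma initial_consS n t k :
  initial (concat (single n) t) k.+1 = concat (single n) (initial t k).
Proof. by rewrite /initial decode_cons /concat /single !CodeSeq.codeK. Qed.

Lemma border_cons S n t : S empty ->
  border S (concat (single n) t) <-> border (restr_set S (single n)) t.
Proof.
move=> S0; split=> -[nS inS]; split=> // u [k lt_k ->].
  by rewrite /restr_set -initial_consS; apply: inS; exists k.+1; rewrite ?len_cons.
(* The empty sequence is the only proper initial segment not beginning with [n]; here [S empty]
   enters. *)
case: k lt_k => [|k] lt_k; first by rewrite initial0.
by rewrite initial_consS; apply: (inS (initial t k)); exists k; rewrite // -ltnS -(len_cons n).
Qed.

(** Deleting the first move shifts positions by one, so even positions become odd and the players
    exchange roles; position 0 remains as a condition on the first move. *)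
Lemma follows_I_cons n t sigma :
  follows_I (concat (single n) t) sigma <->
  n = sigma empty /\ follows_II t (restr sigma (single n)).
Proof.
split=> [F|[n0 F] [|k]].
- split=> [|k]; first by have := F 0; rewrite muln0 len_cons entry_cons0 initial0; apply.
  by have := F k.+1; rewrite addn1 len_cons mulnS add2n entry_consS initial_consS.
- by rewrite muln0 entry_cons0 initial0.
have := F k.
by rewrite addn1 len_cons mulnS add2n entry_consS initial_consS.
Qed.

Lemma follows_II_cons n t tau :
  follows_II (concat (single n) t) tau <-> follows_I t (restr tau (single n)).
Proof.
by split=> F k; have := F k;
  rewrite len_cons addn1 ltnS entry_consS initial_consS.
Qed.

Lemma eq_follows_I s sigma sigma' :
  sigma =1 sigma' -> follows_I s sigma' -> follows_I s sigma.
Proof. by move=> eq_s F n lt_n; rewrite eq_s; apply: F. Qed.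

Lemma eq_follows_II s tau tau' :
  tau =1 tau' -> follows_II s tau' -> follows_II s tau.
Proof. by move=> eq_t F n lt_n; rewrite eq_t; apply: F. Qed.

Lemma eq_winning_I S sigma sigma' alpha :
  sigma =1 sigma' -> winning_I S sigma alpha -> winning_I S sigma' alpha.
Proof. by move=> eq_s W s Bs /(eq_follows_I _ _ _ eq_s); apply: W. Qed.

Lemma eq_winning_II S tau tau' alpha :
  tau =1 tau' -> winning_II S tau alpha -> winning_II S tau' alpha.
Proof. by move=> eq_t W s Bs /(eq_follows_II _ _ _ eq_t); apply: W. Qed.

(** Deleting a move flips the parity of the length, which turns the winning condition of one player
    into that of the other. The empty sequence lies in [S], so every border element has a first move
    to delete. *)
Lemma winning_I_cons S sigma alpha : S empty ->
  winning_I S sigma alpha <->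
  winning_II (restr_set S (single (sigma empty)))
    (restr sigma (single (sigma empty))) (restr alpha (single (sigma empty))).
Proof.
move=> S0; split=> W s Bs.
  move=> Fs; have := W (concat (single (sigma empty)) s).
  rewrite len_cons /= negbK border_cons // follows_I_cons.
  by case=> // *; split.
case: (empty_or_cons s) Bs => [->|[n [t ->]]]; first by case.
rewrite border_cons // follows_I_cons len_cons /= negbK => Bt [n0].
by rewrite n0 in Bt * => Ft; have [] := W t Bt Ft.
Qed.

Lemma winning_II_cons S tau alpha : S empty ->
  winning_II S tau alpha <->
  forall n, winning_I (restr_set S (single n))
    (restr tau (single n)) (restr alpha (single n)).
Proof.
move=> S0; split=> [W n s Bs Fs | W s Bs].
  have := W (concat (single n) s).
  rewrite len_cons /= negbK border_cons // follows_II_cons.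
  by case=> // *; split.
case: (empty_or_cons s) Bs => [->|[n [t ->]]]; first by case.
rewrite border_cons // follows_II_cons len_cons /= negbK => Bt Ft.
by have [] := W n t Bt Ft.
Qed.

(** Restricting [one_star] to a single move leaves the empty set, where the game is already over.
    Treating this set as a game lets the base case use the same one-move decomposition as the
    inductive step. *)
Lemma border_set0 S s : (forall t, ~ S t) -> border S s <-> s = empty.
Proof.
move=> S0; split=> [[_ inS] | ->].
  case: (empty_or_cons s) inS => // -[n [t ->]] inS; case: (S0 empty).
  by apply: inS; exists 0; rewrite ?len_cons ?initial0.
by split=> // t [k]; rewrite len_empty.
Qed.

Lemma winning_I_set0 S sigma alpha : (forall t, ~ S t) ->
  winning_I S sigma alpha <-> alpha empty = 0.
Proof.
move=> S0; split=> [W | a0 s]; last first.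
  by rewrite border_set0 // => -> _; rewrite len_empty.
have F : follows_I empty sigma by move=> n; rewrite len_empty.
have /(W empty)/(_ F)[] : border S empty by rewrite border_set0.
by rewrite len_empty => ->.
Qed.

Lemma winning_II_set0 S tau alpha : (forall t, ~ S t) ->
  winning_II S tau alpha <-> alpha empty <> 0.
Proof.
move=> S0; split=> [W | a0 s]; last first.
  by rewrite border_set0 // => -> _; rewrite len_empty.
have F : follows_II empty tau by move=> n; rewrite len_empty.
have /(W empty)/(_ F)[] : border S empty by rewrite border_set0.
by rewrite len_empty => /(_ isT).
Qed.

(** The head of a nonempty position is dropped unchecked, since it equals [n] in every play that
    follows the strategy. *)
Definition strategy_cons (n : nat) (tau : baire) : baire := fun s =>
  if CodeSeq.decode s is _ :: u then tau (CodeSeq.code u) else n.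

Lemma strategy_cons_empty n tau : strategy_cons n tau empty = n.
Proof. by rewrite /strategy_cons /empty CodeSeq.codeK. Qed.

Lemma restr_strategy_cons n tau m :
  restr (strategy_cons n tau) (single m) =1 tau.
Proof. by move=> t; rewrite /restr /strategy_cons decode_cons CodeSeq.decodeK. Qed.

Lemma exists_winning_I S alpha : S empty ->
  (exists sigma, winning_I S sigma alpha) <->
  exists n tau, winning_II (restr_set S (single n)) tau (restr alpha (single n)).
Proof.
move=> S0; split=> [[sigma] | [n [tau W]]].
  by rewrite winning_I_cons // => W; exists (sigma empty), (restr sigma (single (sigma empty))).
exists (strategy_cons n tau); rewrite winning_I_cons // strategy_cons_empty.
by apply: eq_winning_II W => t; rewrite restr_strategy_cons.
Qed.

Lemma exists_winning_II (AC : second_countable_choice) S alpha : S empty ->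
  (exists tau, winning_II S tau alpha) <->
  forall n, exists sigma,
    winning_I (restr_set S (single n)) sigma (restr alpha (single n)).
Proof.
move=> S0; split=> [[tau] + n | W].
  by rewrite winning_II_cons // => W; exists (restr tau (single n)).
(* The first subgoal is the condition that the relation given to choice respects pointwise
   equality. *)
have [m s s' eq_s|tau Wtau] := AC _ _ W; first exact: eq_winning_I.
by exists tau; rewrite winning_II_cons.
Qed.

Lemma restr_one_star S n t :
  set_eq S one_star -> ~ restr_set S (single n) t.
Proof. by move=> S1; rewrite /restr_set S1; apply: concat_single_neq_empty. Qed.

Lemma Hrs_empty S : Hrs S -> S empty.
Proof. by case=> {}S => [|T _] ->; [| left]. Qed.

(** Every [n] codes a unique pair; its second component selects the stump and its first only numbers
    the repetitions. *)
Lemma restr_hrs_sup S T n :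
  set_eq S (hrs_sup T) ->
  set_eq (restr_set S (single n)) (T (snd (Cantor.of_nat n))).
Proof.
move=> ST t; rewrite /restr_set ST; split.
  case=> [/concat_single_neq_empty // | [m [k [u [Tu]]]]].
  by case/concat_single_inj => -> ->; rewrite /pairing Cantor.cancel_of_to.
move=> Tt; right; exists (fst (Cantor.of_nat n)), (snd (Cantor.of_nat n)), t.
by rewrite /pairing -surjective_pairing Cantor.cancel_to_of.
Qed.

Lemma hrs_sup_neq_one_star S T :
  Hrs (T 0) -> set_eq S (hrs_sup T) -> ~ set_eq S one_star.
Proof.
move=> /Hrs_empty T0 ST S1.
have /S1 : S (concat (single (pairing 0 0)) empty).
  by rewrite ST; right; exists 0, 0, empty.
exact: concat_single_neq_empty.
Qed.

(** Restrictions of a stump agree with the sets [T n] only extensionally, hence the quantification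
    over [S']. Both equivalences are proved together because each move alternates between them. *)
Lemma lead_winning (AC : second_countable_choice) S : Hrs S ->
  forall S', set_eq S' S -> forall alpha,
    (leadE S' alpha <-> exists sigma, winning_I S' sigma alpha) /\
    (leadA S' alpha <-> exists tau, winning_II S' tau alpha).
Proof.
elim=> {}S => [S1 | T HT IH ST] S' SS' alpha.
  have S'1 : set_eq S' one_star by move=> s; rewrite SS'.
  have S'0 : S' empty by rewrite S'1.
  have eq_a n : restr alpha (single n) empty = alpha (single n).
    by rewrite /restr concat_empty.
  have R0 n := fun t => restr_one_star _ n t S'1.
  rewrite leadE_oneP // leadA_oneP // exists_winning_I // exists_winning_II //.
  split; split.
  (* No move remains after the first, so an arbitrary strategy serves as witness. *)
  - by case=> n an; exists n, (fun=> 0); rewrite winning_II_set0 ?eq_a.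
  - by case=> n [tau]; rewrite winning_II_set0 ?eq_a //; exists n.
  - by move=> an n; exists (fun=> 0); rewrite winning_I_set0 ?eq_a.
  - by move=> W n; have [sigma] := W n; rewrite winning_I_set0 ?eq_a.
have S'T : set_eq S' (hrs_sup T) by move=> s; rewrite SS'.
have S'0 : S' empty by rewrite S'T; left.
have nS'1 := hrs_sup_neq_one_star _ _ (HT 0) S'T.
have IHn n := IH _ _ (restr_hrs_sup _ _ n S'T) (restr alpha (single n)).
rewrite leadE_stepP // leadA_stepP // exists_winning_I // exists_winning_II //.
split; split.
- by case=> n /(proj2 (IHn n)); exists n.
- by case=> n /(proj2 (IHn n)); exists n.
- by move=> W n; apply/(proj1 (IHn n)).
- by move=> W n; apply/(proj1 (IHn n)).
Qed.

Theorem theorem3p9 (AC : second_countable_choice)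
    (S : nat_set) (HS : Hrs S) :
  (forall alpha sigma : baire, winning_I S sigma alpha -> leadE S alpha) /\
  (forall alpha tau : baire, winning_II S tau alpha -> leadA S alpha) /\
  (forall alpha : baire, leadE S alpha ->
     exists sigma : baire, winning_I S sigma alpha) /\
  (forall alpha : baire, leadA S alpha ->
     exists tau : baire, winning_II S tau alpha).
Proof.
have L := lead_winning AC _ HS S (fun s => iff_refl (S s)).
split=> [alpha sigma W|]; first by apply/(proj1 (L alpha)); exists sigma.
split=> [alpha tau W|]; first by apply/(proj2 (L alpha)); exists tau.
by split=> alpha; [move/(proj1 (L alpha)) | move/(proj2 (L alpha))].
Qed.
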